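(* Let $I$ be a countably infinite index set and let $X$ be a Banach sequence space over $I$ in which $(e_i)_{i\in I}$ is an OP-basis. Let $N\geq 2$ and let integers $1\leq r_1<r_2<\cdots<r_N$ be given. For each $1\leq l\leq N$, let $T_l=T_{b^{(l)},\varphi_l}:X\to X$ be a weighted pseudo-shift with weight sequence $b^{(l)}=(b^{(l)}_i)_{i\in I}$ and injective mapping $\varphi_l:I\to I$, and let $\psi_l=\varphi_l^{-1}:\varphi_l(I)\to I$. Assume that for each $1\leq l\leq N$ the sequence $(\varphi_l^n)_n$ is run-away, and that for all $1\leq s<l\leq N$ the sequence $(\varphi_s^{r_sn})_n$ is run-away with $(\varphi_l^{r_ln})_n$. Then the following statements are equivalent: (1) $T_1^{r_1},T_2^{r_2},\ldots,T_N^{r_N}$ have a dense set of d-supercyclic vectors. (2) There exists an increasing sequence $(n_k)_{k\geq 1}$ of positive integers such that: for any $i,j\in I$ and $1\leq l,s\leq N$, $$\lim_{k\to\infty}\left\|\left(\prod_{v=0}^{r_ln_k-1}b^{(l)}_{\varphi_l^v(i)}\right)^{-1}e_{\varphi_l^{r_ln_k}(i)}\right\|\left\|\left(\prod_{v=1}^{r_sn_k}b^{(s)}_{\psi_s^v(j)}\right)e_{\psi_s^{r_sn_k}(j)}\right\|=0;$$ and for every $i\in I$ and $1\leq s<l\leq N$, $$\lim_{k\to\infty}\left\|\left(\prod_{v=0}^{r_sn_k-1}b^{(s)}_{\varphi_s^v(i)}\right)^{-1}\left(\prod_{v=1}^{r_ln_k}b^{(l)}_{\psi_l^v(\varphi_s^{r_sn_k}(i))}\right)e_{\psi_l^{r_ln_k}(\varphi_s^{r_sn_k}(i))}\right\|=0,$$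 $$\lim_{k\to\infty}\left\|\left(\prod_{v=0}^{r_ln_k-1}b^{(l)}_{\varphi_l^v(i)}\right)^{-1}\left(\prod_{v=1}^{r_sn_k}b^{(s)}_{\psi_s^v(\varphi_l^{r_ln_k}(i))}\right)e_{\psi_s^{r_sn_k}(\varphi_l^{r_ln_k}(i))}\right\|=0.$$ (3) $T_1^{r_1},T_2^{r_2},\ldots,T_N^{r_N}$ satisfy the d-Supercyclicity Criterion.
   Context: Scalars are complex; $\mathbb{N}=\{0,1,2,\ldots\}$; $L(X)$ denotes the continuous linear operators on $X$; ''increasing'' for a sequence of integers means strictly increasing. Banach sequence space over $I$: a linear subspace $X$ of $\mathbb{C}^I$ endowed with a norm making it a Banach space such that every coordinate functional $(x_k)_{k\in I}\mapsto x_i$ ($i\in I$) is continuous on $X$. OP-basis: let $e_i=(\delta_{ik})_{k\in I}$ be the canonical unit vectors, assumed to lie in $X$. $(e_i)_{i\in I}$ is an OP-basis if $\mathrm{span}\{e_i:i\in I\}$ is dense in $X$ and the family of coordinate projections $x\mapsto x_ie_i$ ($i\in I$) on $X$ is equicontinuous. Weighted pseudo-shift: a continuous linear operator $T=T_{b,\varphi}:X\to X$ of the form $T(x_i)_{i\in I}=(b_ix_{\varphi(i)})_{i\in I}$, where $b=(b_i)_{i\in I}$ is a sequence of non-zero scalars (the weight sequence) and $\varphi:I\to I$ is injective. Conventions: $\varphi^n$ is the $n$-fold composition of $\varphi$. With $\psi=\varphi^{-1}:\varphi(I)\to I$, $\psi^n$ is the $n$-fold composition of the partially defined map $\psi$;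 whenever $\psi^n(i)$ is undefined one sets $b_{\psi^n(i)}=0$ and $e_{\psi^n(i)}=0$. The same conventions apply to each $\varphi_l,\psi_l,b^{(l)}$. Run-away: for $\varphi:I\to I$, the sequence $(\varphi^n)_n$ is run-away if for every finite $I_0\subset I$ there is $n_0\in\mathbb{N}$ with $\varphi^n(I_0)\cap I_0=\emptyset$ for every $n\geq n_0$. For maps $\varphi_1,\varphi_2:I\to I$, $(\varphi_1^n)_n$ is run-away with $(\varphi_2^n)_n$ if for every finite $I_0\subset I$ there is $n_0\in\mathbb{N}$ such that $\varphi_1^n(I_0)\cap\varphi_2^n(I_0)=\emptyset$ for every $n\geq n_0$; this is applied to the maps $\varphi_s^{r_s}$ and $\varphi_l^{r_l}$. d-supercyclicity: $T\in L(X)$ is supercyclic if $\{\lambda T^nx:n\in\mathbb{N},\lambda\in\mathbb{C}\}$ is dense in $X$ for some $x\in X$. For $N\geq 2$ and supercyclic operators $T_1,\ldots,T_N\in L(X)$, a vector $x\in X$ is d-supercyclic if $\{\lambda(T_1^nx,\ldots,T_N^nx):n\in\mathbb{N},\lambda\in\mathbb{C}\}$ is dense in $X^N$. d-Supercyclicity Criterion: $T_1,\ldots,T_N\in L(X)$ satisfy it with respect to a strictly increasing sequence $(n_k)_k$ of positive integers if there exist dense subsets $X_0,X_1,\ldots,X_N$ of $X$ and mappings $S_{l,k}:X_l\to X$ ($1\leq l\leq N$, $k\in\mathbb{N}$) such that for $1\leq l\leq N$: (i) $T_l^{n_k}S_{i,k}-\delta_{i,l}\mathrm{Id}_{X_i}\to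 0$ pointwise on $X_i$ as $k\to\infty$, for $1\leq i\leq N$; (ii) $\lim_{k\to\infty}\|T_l^{n_k}x\|\cdot\left\|\sum_{j=1}^NS_{j,k}y_j\right\|=0$ for all $x\in X_0$ and $y_j\in X_j$ ($1\leq j\leq N$). They satisfy the d-Supercyclicity Criterion if they do so with respect to some such sequence. *)

(* Defs.v *)
From HB Require Import structures.
From mathcomp Require Import all_boot all_order all_algebra.
From mathcomp Require Import complex.
From mathcomp Require Import all_classical all_reals all_analysis.

Set Implicit Arguments.
Unset Strict Implicit.
Unset Printing Implicit Defensive.

Import Order.TTheory GRing.Theory Num.Theory.
Import numFieldNormedType.Exports.

Local Open Scope classical_set_scope.
Local Open Scope ring_scope.

(* Naming the complex numbers as a numFieldType gives access to their
   topology and to normed modules over them; norms are then valued in the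
   nonnegative reals of [Cplx R]. *)
Definition Cplx (R : realType) : numFieldType := (R[i])%C.

Section SequenceSpaces.
Variables (R : realType) (I : choiceType) (X : completeNormedModType (Cplx R)).

(* The subspace of C^I is presented as an abstract Banach space [X] with an
   injective linear map [coord] into I -> C: [coord x i] is the i-th
   coordinate of [x]. *)
Definition banach_sequence_space (coord : X -> I -> Cplx R) : Prop :=
  [/\ forall i, scalar (fun x => coord x i),
      injective coord &
      forall i, continuous (fun x => coord x i)].

Definition unit_vectors (coord : X -> I -> Cplx R) (e : I -> X) : Prop :=
  forall i k, coord (e i) k = (i == k)%:R.

Definition span (e : I -> X) : set X :=
  [set x | exists (s : seq I) (c : I -> Cplx R), x = \sum_(i <- s) c i *: e i].

Definition OP_basis (coord : X -> I -> Cplx R) (e : I -> X) : Prop :=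
  [/\ unit_vectors coord e,
      dense (span e) &
      equicontinuous [set: I] (fun (i : I) (x : X) => coord x i *: e i)].

Definition weighted_pseudo_shift (coord : X -> I -> Cplx R)
    (b : I -> Cplx R) (phi : I -> I) (T : X -> X) : Prop :=
  [/\ linear T, continuous T,
      forall i, b i != 0,
      injective phi &
      forall x i, coord (T x) i = b i * coord x (phi i)].

End SequenceSpaces.

Section Index.
Variable I : Type.

Definition partial_inverse (phi : I -> I) (j : I) : option I :=
  if pselect (exists i, phi i = j) is left h then Some (projT1 (cid h))
  else None.

(* n-fold composition of psi = phi^-1; [None] means "undefined". *)
Definition psi_iter (phi : I -> I) (n : nat) (j : I) : option I :=
  iter n (obind (partial_inverse phi)) (Some j).

Definition run_away (phi : I -> I) : Prop :=
  forall I0 : set I, finite_set I0 ->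
    exists n0 : nat, forall n : nat, (n0 <= n)%N ->
      (iter n phi @` I0) `&` I0 = set0.

Definition run_away_with (phi1 phi2 : I -> I) : Prop :=
  forall I0 : set I, finite_set I0 ->
    exists n0 : nat, forall n : nat, (n0 <= n)%N ->
      (iter n phi1 @` I0) `&` (iter n phi2 @` I0) = set0.

End Index.

Section Weights.
Variables (R : realType) (I : Type) (X : completeNormedModType (Cplx R)).

(* Values at psi^n(j), which are 0 where psi^n(j) is undefined. *)
Definition b_psi (b : I -> Cplx R) (phi : I -> I) (n : nat) (j : I) : Cplx R :=
  oapp b 0 (psi_iter phi n j).

Definition e_psi (e : I -> X) (phi : I -> I) (n : nat) (j : I) : X :=
  oapp e 0 (psi_iter phi n j).

Definition fwd_weight (b : I -> Cplx R) (phi : I -> I) (m : nat) (i : I) :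
    Cplx R :=
  \prod_(0 <= v < m) b (iter v phi i).

Definition bwd_weight (b : I -> Cplx R) (phi : I -> I) (m : nat) (j : I) :
    Cplx R :=
  \prod_(1 <= v < m.+1) b_psi b phi v j.

End Weights.

Section Supercyclicity.
Variables (R : realType) (X : completeNormedModType (Cplx R)).

Definition supercyclic (T : X -> X) : Prop :=
  exists x : X,
    dense [set y | exists (n : nat) (lambda : Cplx R), y = lambda *: iter n T x].

Variable N : nat.

Definition d_supercyclic_vector (T : 'I_N -> X -> X) (x : X) : Prop :=
  (forall l, supercyclic (T l)) /\
  dense ([set y | exists (n : nat) (lambda : Cplx R),
                    y = (fun l => lambda *: iter n (T l) x)]
         : set (prod_topology (fun _ : 'I_N => X))).

(* The maps S_{l,k} : X_l -> X are given as total maps, of which only the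
   values on X_l are used. *)
Definition d_supercyclicity_criterion_wrt (T : 'I_N -> X -> X) (n : nat -> nat)
    : Prop :=
  exists (X0 : set X) (Xs : 'I_N -> set X) (S : 'I_N -> nat -> X -> X),
    [/\ dense X0,
        forall l, dense (Xs l),
        forall l i (y : X), Xs i y ->
          (fun k => iter (n k) (T l) (S i k y) - (i == l)%:R *: y) @ \oo
            --> (0 : X) &
        forall l (x : X) (y : 'I_N -> X), X0 x -> (forall j, Xs j (y j)) ->
          (fun k => `|iter (n k) (T l) x| * `|\sum_(j < N) S j k (y j)|) @ \oo
            --> (0 : Cplx R)].

Definition d_supercyclicity_criterion (T : 'I_N -> X -> X) : Prop :=
  exists n : nat -> nat,
    [/\ increasing_seq n, forall k, (0 < n k)%N &
        d_supercyclicity_criterion_wrt T n].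

End Supercyclicity.

(* Main.v *)
Require Import Defs.
From HB Require Import structures.
From mathcomp Require Import all_boot all_order all_algebra.
From mathcomp Require Import complex.
From mathcomp Require Import all_classical all_reals all_analysis.
From mathcomp Require Import ring.

Set Implicit Arguments.
Unset Strict Implicit.
Unset Printing Implicit Defensive.

Import Order.TTheory GRing.Theory Num.Theory.
Import numFieldNormedType.Exports.

Local Open Scope classical_set_scope.
Local Open Scope ring_scope.

(** Write [fwd_vector m i] for the vector (prod b)^-1 e_(phi^m i), which the
m-th iterate of the pseudo-shift T sends back to e_i, and note that the
backward products in the weight conditions are exactly the vectors T^m e_j
([bwd_weight_e_psi]).  The weight conditions therefore say that, along n_k,
the products |fwd_vector_l i| |T_s e_j| tend to 0, and that T_l applied to
fwd_vector_s i tends to 0 whenever s <> l ([decay_along]).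

From the weight conditions to the criterion ([decay_criterion]): all the dense
sets are the span of the e_i, and S_{l,k} replaces e_i by [fwd_vector] in some
expansion of the argument.  Every limit is then a finite sum of limits given by
the weight conditions.

From the criterion to d-supercyclicity: it is enough that for all nonempty open
U, V_1, ..., V_N some scaled joint iterate sends a point of U into the product
of the V_l ([criterion_d_transitive]).  The point is x + mu * sum_j S_j y_j
and the scaling factor is 1 / mu, where mu is chosen so that both
mu |sum_j S_j y_j| and |T_l x| / mu are small; this is possible because the
product of the two norms is small.  As X is separable, Baire's theorem turns
this transitivity into a dense set of d-supercyclic vectors
([d_transitive_dense_d_supercyclic]).

From d-supercyclicity to the weight conditions ([small_index]): given a finite
set I0 of indices, take a d-supercyclic x close to the sum f of the e_i with i
in I0, and n, lambda such that, writing T_l and phi_l for their iterates of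
order r_l n, every lambda T_l x is close to f as well, with n so large that the
sets phi_l(I0) avoid I0 and one another.  Being close to f
means that the coordinates on I0 are close to 1 while those off I0 contribute
little in norm, and equicontinuity of the coordinate projections makes this
uniform in the coordinate.  Comparing a coordinate of lambda T_l x at i with
the coordinate of x at phi_l(i), once for i in I0 and once for i off I0, bounds
the vectors above.  That n can be taken large is [d_supercyclic_large_index]:
finitely many indices only contribute finitely many lines of X^N, which a
perturbation of the target avoids. *)

(** * Small radii, Baire's theorem and open sets of a finite power *)

Lemma Cplx_invn_small (R : realType) (eps : Cplx R) :
  0 < eps -> exists p : nat, p.+1%:R^-1 < eps.
Proof.
case: eps => x y /=; rewrite ltcE /= => /andP[/eqP -> x0].
exists (Num.Def.archi_bound x^-1).
have h : x^-1 < (Num.Def.archi_bound x^-1).+1%:R.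
  rewrite (lt_le_trans (archi_boundP _)) ?ler_nat// invr_ge0; exact: ltW.
rewrite (_ : _%:R^-1 = (((Num.Def.archi_bound x^-1).+1%:R)^-1)%:C%C); last first.
  by rewrite fmorphV rmorph_nat.
by rewrite -[X in _ < X]/(x%:C)%C ltcR invf_plt ?posrE.
Qed.

(** Plays the part of a minimum over the list, which the partial order of the
complex numbers makes awkward to take. *)
Lemma Cplx_pos_lower_bound (R : realType) (s : seq (Cplx R)) :
  (forall x, x \in s -> 0 < x) ->
  exists p : nat, forall x, x \in s -> p.+1%:R^-1 < x.
Proof.
elim: s => [|x s IH] hs; first by exists 0%N.
have [p hp] := Cplx_invn_small (hs x (mem_head _ _)).
have [|q hq] := IH; first by move=> y ys; apply: hs; rewrite inE ys orbT.
have le_inv m n : (m <= n)%N -> n.+1%:R^-1 <= m.+1%:R^-1 :> Cplx R.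
  by move=> mn; rewrite lef_pV2 ?posrE// ler_nat.
exists (maxn p q) => y; rewrite inE => /orP[/eqP ->|ys].
  by apply: le_lt_trans hp; apply: le_inv; exact: leq_maxl.
by apply: le_lt_trans (hq _ ys); apply: le_inv; exact: leq_maxr.
Qed.

Section Baire.
Variables (R : realType) (X : completeNormedModType (Cplx R)).

Lemma open_ball_sub (V : set X) (x : X) : open V -> V x ->
  exists2 eps : Cplx R, 0 < eps & forall y, `|x - y| < eps -> V y.
Proof.
move=> oV Vx; have : nbhs x V by apply: open_nbhs_nbhs.
move=> /nbhs_normP[eps /= e0 h]; exists eps => // y xy; exact: h.
Qed.

Lemma open_lt_dist (x : X) (eps : Cplx R) : open [set y | `|x - y| < eps].
Proof.
by have := @ball_open _ X x eps; rewrite -ball_normE; apply.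
Qed.

(** Nested closed balls of radii 1 / (p + 1).  The radii are kept in this form
so that shrinking a ball is a choice of natural numbers. *)
Lemma Cplx_Baire (F : nat -> set X) :
  (forall k, open (F k)) -> (forall k, dense (F k)) ->
  dense (\bigcap_k F k).
Proof.
move=> oF dF O [x0 Ox0] oO.
pose rad (p : nat) : Cplx R := p.+1%:R^-1.
have rad_gt0 p : 0 < rad p by rewrite invr_gt0 ltr0n.
have shrink (V : set X) x k : open V -> V x ->
    exists2 p, (k <= p)%N & forall y, `|x - y| <= rad p -> V y.
  move=> oV Vx; have [eps e0 h] := open_ball_sub oV Vx.
  have [p hp] := Cplx_invn_small e0; exists (maxn k p); first exact: leq_maxl.
  move=> y xy; apply: h; apply: le_lt_trans hp; apply: (le_trans xy).
  by rewrite lef_pV2 ?posrE// ler_nat ltnS leq_maxr.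
have [p0 _ hp0] := shrink O x0 0%N oO Ox0.
have step (kc : nat * (X * nat)) : exists d : X * nat, (kc.1 <= d.2)%N /\
    forall y, `|d.1 - y| <= rad d.2 -> `|kc.2.1 - y| < rad kc.2.2 /\ F kc.1 y.
  case: kc => k [x p] /=.
  pose V := [set y | `|x - y| < rad p].
  have oV : open V by exact: open_lt_dist.
  have [x' [Vx' Fx']] : (V `&` F k) !=set0.
    by apply: dF => //; exists x; rewrite /V /= subrr normr0.
  have [q kq hq] := shrink _ x' k (openI oV (oF k)) (conj Vx' Fx').
  by exists (x', q); split.
have [f Pf] := choice step.
(* [u n] is a centre together with the index p of its radius 1 / (p + 1). *)
pose fix u n := if n is m.+1 then f (m, u m) else (x0, p0).
have nested n m y : (n <= m)%N ->
    `|(u m).1 - y| <= rad (u m).2 -> `|(u n).1 - y| <= rad (u n).2.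
  elim: m => [|m IH]; first by rewrite leqn0 => /eqP ->.
  rewrite leq_eqVlt => /orP[/eqP -> //|nm h]; apply: IH => //.
  by have [_ /(_ _ h)[/ltW]] := Pf (m, u m).
have near_center n m : (n <= m)%N -> `|(u n).1 - (u m).1| <= rad (u n).2.
  by move=> nm; apply: (nested _ _ _ nm); rewrite subrr normr0 ltW.
have cu : cauchy ((fun n => (u n).1) @ \oo).
  apply: cauchy_exP => eps e0; have [p hp] := Cplx_invn_small e0.
  exists (u p.+1).1; exists p.+1 => // m /= pm.
  rewrite -ball_normE /ball_ /=; apply: le_lt_trans (near_center _ _ pm) _.
  apply: le_lt_trans hp; rewrite lef_pV2 ?posrE// ler_nat ltnS.
  by have [] := Pf (p, u p).
have /cvg_ex[a ua] : cvg ((fun n => (u n).1) @ \oo) by exact/cauchy_cvgP.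
have in_ball n : `|(u n).1 - a| <= rad (u n).2.
  apply/ler_addgt0Pr => eps e0.
  have [m nm ma] : exists2 m, (n <= m)%N & `|(u m).1 - a| < eps.
    have /cvgrPdist_lt/(_ eps e0)[m0 _ hm] := ua.
    exists (maxn n m0); first exact: leq_maxl.
    by rewrite distrC; apply: hm => /=; exact: leq_maxr.
  rewrite -(subrKA (u m).1) (le_trans (ler_normD _ _))// lerD ?near_center//.
  exact: ltW.
exists a; split; first exact: hp0 (in_ball 0%N).
by move=> k _; have [_ /(_ a (in_ball k.+1))[]] := Pf (k, u k).
Qed.

End Baire.

Lemma open_forall (Y : topologicalType) (J : finType) (V : J -> set Y) :
  (forall j, open (V j)) -> open [set y | forall j, V j y].
Proof.
move=> oV; rewrite openE => y /= Vy; rewrite /interior /=.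
by apply: filter_forall => j; apply: open_nbhs_nbhs; split; [exact: oV | exact: Vy].
Qed.

Section ProductNeighbourhoods.
Variables (R : realType) (X : completeNormedModType (Cplx R)) (N : nat).

Lemma open_box (V : 'I_N -> set X) : (forall l, open (V l)) ->
  open ([set z | forall l, V l (z l)] : set (prod_topology (fun _ : 'I_N => X))).
Proof.
move=> oV; apply: (@open_forall (prod_topology (fun _ : 'I_N => X))
  'I_N (fun l => [set z | V l (z l)])) => l.
rewrite openE => z Vz; rewrite /interior /=.
have /(_ z) := @proj_continuous 'I_N (fun _ => X) l; apply.
by apply: open_nbhs_nbhs; split; [exact: oV | exact: Vz].
Qed.

(** Otherwise there would be points outside O approaching y uniformly in the
coordinates, and uniform convergence implies convergence in the product. *)
Lemma open_prod_sub_box (O : set (prod_topology (fun _ : 'I_N => X)))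
    (y : 'I_N -> X) : open O -> O y ->
  exists p : nat, forall z : 'I_N -> X,
    (forall l, `|y l - z l| < p.+1%:R^-1) -> O z.
Proof.
move=> oO Oy; apply: contrapT => /forallNP hn.
have hz p : exists z : 'I_N -> X,
    (forall l, `|y l - z l| < p.+1%:R^-1) /\ ~ O z.
  by have /existsNP[z /not_implyP[]] := hn p; exists z.
have [z hz'] := choice hz.
have cz : (z : nat -> prod_topology (fun _ : 'I_N => X)) @ \oo
    --> (y : prod_topology (fun _ : 'I_N => X)).
  apply/cvg_sup => l; apply/cvg_image.
    rewrite eqEsubset; split => // v _; exists (fun=> v) => //.
  apply: (@cvg_trans _ ((fun n => z n l) @ \oo)).
    move=> A /= HA; exists [set f | A (f l)] => //.
    by rewrite eqEsubset; split=> [_ [f Af <-] //|v Av]; exists (fun=> v).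
  apply/cvgrPdist_lt => eps e0; have [p hp] := Cplx_invn_small e0.
  exists p => // n /= pn; apply: lt_trans hp.
  apply: lt_le_trans ((hz' n).1 l) _.
  by rewrite lef_pV2 ?posrE// ler_nat.
have : nbhs (y : prod_topology (fun _ : 'I_N => X)) O by apply: open_nbhs_nbhs.
move=> /cz [n _ /(_ n (leqnn n))] /=; exact: (hz' n).2.
Qed.

End ProductNeighbourhoods.
(** * Linear maps and null sequences *)

Lemma iter_iter (A : Type) (f : A -> A) r m x :
  iter m (iter r f) x = iter (r * m) f x.
Proof. by elim: m => [|m IH]; rewrite ?muln0//= IH mulnS iterD. Qed.

Section Operators.
Variables (R : realType) (X : completeNormedModType (Cplx R)).
Implicit Types T : X -> X.

Lemma iter_linear T m : linear T -> linear (iter m T).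
Proof. by move=> hT; elim: m => [|m IH] a x y //=; rewrite IH hT. Qed.

Lemma iter_continuous T m : continuous T -> continuous (iter m T).
Proof.
move=> hT; elim: m => [|m IH] x; first by move=> A.
by apply: (@continuous_comp _ _ _ (iter m T) T); [exact: IH | exact: hT].
Qed.

Lemma linear0_of T : linear T -> T 0 = 0.
Proof. by move=> hT; have := hT (-1) 0 0; rewrite !scaleN1r !addNr. Qed.

Lemma linearD_of T x y : linear T -> T (x + y) = T x + T y.
Proof. by move=> hT; have := hT 1 x y; rewrite !scale1r. Qed.

Lemma linearZ_of T a x : linear T -> T (a *: x) = a *: T x.
Proof. by move=> hT; have := hT a x 0; rewrite !addr0 linear0_of// addr0. Qed.

Lemma linear_sum_of T (J : Type) (s : seq J) (P : pred J) (v : J -> X) :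
  linear T -> T (\sum_(j <- s | P j) v j) = \sum_(j <- s | P j) T (v j).
Proof.
move=> hT; apply: (big_morph T _ (linear0_of hT)) => x y; exact: linearD_of.
Qed.

Lemma cvg0_sum (V : pseudoMetricNormedZmodType (Cplx R)) (J : Type) (s : seq J)
    (u : J -> nat -> V) :
  (forall j, u j @ \oo --> (0 : V)) ->
  (fun k => \sum_(j <- s) u j k) @ \oo --> (0 : V).
Proof.
move=> hu; elim: s => [|j s IH].
  by under eq_fun do rewrite big_nil; exact: cvg_cst.
under eq_fun do rewrite big_cons.
have h := cvgD (hu j) IH; rewrite addr0 in h; exact: h.
Qed.

Lemma cvg0_le (u v : nat -> Cplx R) : (forall k, `|u k| <= `|v k|) ->
  v @ \oo --> (0 : Cplx R) -> u @ \oo --> (0 : Cplx R).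
Proof.
move=> uv /cvgr0Pnorm_lt hv; apply/cvgr0Pnorm_lt => eps e0.
by apply: filterS (hv eps e0) => k; apply: le_lt_trans.
Qed.

End Operators.

(** * Separability *)

Section Separability.
Variable R : realType.

Lemma ratr_approx (x eps : R) : 0 < eps -> exists q : rat, `|x - ratr q| < eps.
Proof.
move=> e0; have h : x - eps < x + eps by rewrite ltrBlDr -addrA ltrDl addr_gt0.
have [q] := rat_in_itvoo h; rewrite in_itv /= => hq; exists q.
by rewrite distrC ltr_distl.
Qed.

Definition Cplx_of_rat (q : rat * rat) : Cplx R := (ratr q.1 +i* ratr q.2)%C.

Lemma Cplx_of_rat_approx (z eps : Cplx R) : 0 < eps ->
  exists q, `|z - Cplx_of_rat q| < eps.
Proof.
case: eps => d d'; rewrite ltcE /= => /andP[/eqP -> d0].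
case: z => x y.
have d20 : 0 < d / 2 by rewrite divr_gt0.
have [p hp] := ratr_approx x d20; have [q hq] := ratr_approx y d20.
exists (p, q).
have -> : (x +i* y)%C - Cplx_of_rat (p, q)
    = ((x - ratr p) +i* 0)%C + (0 +i* (y - ratr q))%C :> Cplx R.
  by apply/eqP; rewrite eq_complex /= addr0 add0r !eqxx.
apply: le_lt_trans (ler_normD _ _) _.
have -> : `|((x - ratr p) +i* 0)%C : Cplx R| = (`|x - ratr p|)%:C%C.
  by rewrite [LHS]normc_def /= expr0n addr0 sqrtr_sqr.
have -> : `|(0 +i* (y - ratr q))%C : Cplx R| = (`|y - ratr q|)%:C%C.
  by rewrite [LHS]normc_def /= expr0n add0r sqrtr_sqr.
rewrite -rmorphD -[X in _ < X]/(d%:C)%C ltcR (splitr d); exact: ltrD.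
Qed.

(** The countable dense set consists of the combinations of the e_i whose
coefficients have rational real and imaginary parts. *)
Lemma span_separable (I : choiceType) (X : completeNormedModType (Cplx R))
    (e : I -> X) : countable [set: I] -> [set: I] !=set0 -> dense (Defs.span e) ->
  exists d : nat -> X, forall V : set X, V !=set0 -> open V -> exists k, V (d k).
Proof.
move=> cI [i0 _] de.
have [h hh] : exists h : nat -> I, forall i, exists n, h n = i.
  have /countable_injP[f finj] := cI.
  exists (fun n => xget i0 [set i | f i = n]) => i; exists (f i).
  have : [set j | f j = f i] (xget i0 [set j | f j = f i]).
    by apply: (xgetPex i0); exists i.
  by move=> /finj; apply; rewrite inE.
pose D (t : seq (nat * (rat * rat))) :=
  \sum_(a <- t) Cplx_of_rat a.2 *: e (h a.1).
have approx (s : seq I) c eps : 0 < eps ->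
    exists t, `|\sum_(i <- s) c i *: e i - D t| < eps.
  elim: s eps => [|i s IH] eps e0.
    by exists [::]; rewrite /D !big_nil subrr normr0.
  have e20 : 0 < eps / 2 by rewrite divr_gt0.
  have [t ht] := IH _ e20; have [n hn] := hh i.
  have ei0 : 0 < `|e i| + 1 by rewrite ltr_wpDl.
  have [q hq] := Cplx_of_rat_approx (c i) (divr_gt0 e20 ei0).
  exists ((n, q) :: t); rewrite /D !big_cons /= hn.
  rewrite opprD addrACA -scalerBl (le_lt_trans (ler_normD _ _))//.
  rewrite [ltRHS]splitr; apply: ltr_leD; last exact: ltW.
  rewrite normrZ; apply: le_lt_trans (_ : _ <= `|c i - Cplx_of_rat q| * (`|e i| + 1)) _.
    by rewrite ler_wpM2l// lerDl.
  by rewrite -ltr_pdivlMr.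
exists (fun k => oapp D 0 (unpickle k)) => V V0 oV.
have [x [Vx [s [c xE]]]] := de V V0 oV.
have [eps e0 hV] := open_ball_sub oV Vx.
have [t ht] := approx s c eps e0.
by exists (pickle t); rewrite pickleK /=; apply: hV; rewrite xE.
Qed.

End Separability.

(** * From the criterion to d-supercyclic vectors *)

Section Transitivity.
Variables (R : realType) (X : completeNormedModType (Cplx R)) (N : nat).
Implicit Types T : 'I_N -> X -> X.

(** Disjoint analogue of topological transitivity, up to a common scalar. *)
Definition d_transitive T := forall (U : set X) (V : 'I_N -> set X),
  U !=set0 -> open U -> (forall l, V l !=set0) -> (forall l, open (V l)) ->
  exists x n (lambda : Cplx R), U x /\ forall l, V l (lambda *: iter n (T l) x).

Lemma common_radius (y : 'I_N -> X) (V : 'I_N -> set X) :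
  (forall l, open (V l)) -> (forall l, V l (y l)) ->
  exists2 eps : Cplx R, 0 < eps & forall l z, `|y l - z| < eps -> V l z.
Proof.
move=> oV Vy.
have hr l : exists r : Cplx R, 0 < r /\ forall z, `|y l - z| < r -> V l z.
  by have [r r0 hr] := open_ball_sub (oV l) (Vy l); exists r.
have [r hr'] := choice hr.
have [|p hp] := @Cplx_pos_lower_bound R [seq r l | l <- enum 'I_N].
  by move=> x /mapP[l _ ->]; exact: (hr' l).1.
exists p.+1%:R^-1 => [|l z yz]; first by rewrite invr_gt0 ltr0n.
apply: (hr' l).2; apply: lt_trans yz _; apply: hp.
by apply/mapP; exists l => //; rewrite mem_enum.
Qed.

(** The witness is x + mu *: sum_j S_j y_j, scaled by 1 / mu: the summand in mu
must stay small and so must T_l x / mu.  Both hold for a suitable mu as soon as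
|T_l x| |sum_j S_j y_j| is small, whatever the size of each factor. *)
Lemma criterion_d_transitive T (n : nat -> nat) :
  (forall l, linear (T l)) -> d_supercyclicity_criterion_wrt T n ->
  d_transitive T.
Proof.
move=> linT [X0 [Xs [S [dX0 dXs Hid Hprod]]]] U V U0 oU V0 oV.
have [x [Ux X0x]] := dX0 U U0 oU.
have [y hy] := choice (fun l => dXs l _ (V0 l) (oV l)).
have [eU eU0 hU] := open_ball_sub oU Ux.
have [eV eV0 hV] := common_radius oV (fun l => (hy l).1).
have [|p hp] := @Cplx_pos_lower_bound R [:: eU; eV].
  by move=> z; rewrite !inE => /orP[] /eqP ->.
pose eps : Cplx R := p.+1%:R^-1.
have e0 : 0 < eps by rewrite invr_gt0 ltr0n.
have epsU : eps < eU by apply: hp; rewrite inE eqxx.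
have epsV : eps < eV by apply: hp; rewrite !inE eqxx orbT.
have e20 : 0 < eps / 2 by rewrite divr_gt0.
pose A k := \sum_(l <- enum 'I_N) `|iter (n k) (T l) x|.
pose s k := \sum_(j < N) S j k (y j).
have AB : (fun k => A k * `|s k|) @ \oo --> (0 : Cplx R).
  rewrite /A; under eq_fun do rewrite mulr_suml.
  by apply: cvg0_sum => l; apply: Hprod => // j; exact: (hy j).2.
pose err l k := \sum_(j <- enum 'I_N)
  (iter (n k) (T l) (S j k (y j)) - (j == l)%:R *: y j).
have cerr l : err l @ \oo --> (0 : X).
  by apply: cvg0_sum => j; apply: Hid; exact: (hy j).2.
have /cvgr0Pnorm_lt/(_ _ (exprn_gt0 2 e20)) nAB := AB.
have nerr : \forall k \near \oo, forall l, `|err l k| < eps / 2.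
  apply: filter_forall => l.
  by have /cvgr0Pnorm_lt/(_ _ e20) := cerr l.
have [k [/= hAB herr]] := filter_ex (filterI nAB nerr).
have A0 : 0 <= A k by rewrite sumr_ge0.
rewrite ger0_norm ?mulr_ge0// in hAB.
(* [mu] makes A k / mu at most eps / 2; the slack [del] keeps mu positive when
   A k = 0 and is small enough for mu * |s k| to stay below eps / 2. *)
pose del := ((eps / 2) ^+ 2 - A k * `|s k|) / (`|s k| + 1).
have s1 : 0 < `|s k| + 1 by rewrite ltr_wpDl.
have del0 : 0 < del by rewrite divr_gt0// subr_gt0.
pose mu := (A k + del) / (eps / 2).
have Ad0 : 0 < A k + del by rewrite ltr_wpDl.
have mu0 : 0 < mu by rewrite divr_gt0.
have mus : mu * `|s k| <= eps / 2.
  rewrite /mu mulrAC ler_pdivrMr// -expr2 mulrDl -lerBrDl.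
  rewrite /del mulrAC ler_pdivrMr// ler_wpM2l ?lerDl// subr_ge0; exact: ltW.
exists (x + mu *: s k), (n k), mu^-1; split.
  apply: hU; rewrite opprD addNKr normrN normrZ gtr0_norm//.
  apply: le_lt_trans mus _; apply: lt_trans epsU.
  by rewrite ltr_pdivrMr// ltr_pMr// ltr1n.
move=> l; apply: hV; apply: lt_trans epsV.
have lin := @iter_linear _ _ _ (n k) (linT l).
rewrite (linearD_of _ _ lin) (linearZ_of _ _ lin) scalerDr scalerA.
rewrite mulVf ?gt_eqF// scale1r.
have -> : y l - (mu^-1 *: iter (n k) (T l) x + iter (n k) (T l) (s k))
    = - (mu^-1 *: iter (n k) (T l) x + err l k).
  rewrite /err sumrB /s.
  have -> : iter (n k) (T l) (\sum_(j < N) S j k (y j))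
      = \sum_(j <- enum 'I_N) iter (n k) (T l) (S j k (y j)).
    by rewrite big_enum (linear_sum_of _ _ _ lin).
  have -> : \sum_(j <- enum 'I_N) (j == l)%:R *: y j = y l.
    rewrite big_enum /= (bigD1 l)//= eqxx scale1r big1 ?addr0// => j /negPf ->.
    by rewrite scale0r.
  by rewrite [in RHS]opprD opprB opprD addrCA.
rewrite normrN (le_lt_trans (ler_normD _ _))// [ltRHS]splitr ler_ltD//.
rewrite normrZ normfV gtr0_norm// mulrC ler_pdivrMr//.
rewrite /mu mulrC divfK ?gt_eqF//.
apply: (@le_trans _ _ (A k)); last by rewrite lerDl ltW.
rewrite /A (bigD1_seq l) ?mem_enum ?enum_uniq//= lerDl sumr_ge0//.
Qed.

(** Birkhoff's argument: each [G a] below collects the points whose joint orbit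
enters one box around dense points; it is open, and dense by transitivity, and
there are countably many boxes. *)
Lemma d_transitive_dense_d_supercyclic T :
  (forall l, continuous (T l)) ->
  (exists d : nat -> X, forall V : set X, V !=set0 -> open V -> exists k, V (d k)) ->
  d_transitive T -> dense [set x | d_supercyclic_vector T x].
Proof.
move=> cT [d hd] trT.
pose G (a : {ffun 'I_N -> nat} * nat) := [set x | exists n (lambda : Cplx R),
  forall l, `|d (a.1 l) - lambda *: iter n (T l) x| < a.2.+1%:R^-1].
(* Natural numbers that encode no box impose no constraint. *)
pose F m := oapp G setT (unpickle m).
have oG a : open (G a).
  rewrite openE => x [n [lam hx]]; rewrite /interior /=.
  have : \forall z \near x, forall l,
      `|d (a.1 l) - lam *: iter n (T l) z| < a.2.+1%:R^-1.
    apply: filter_forall => l.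
    have cl : {for x, continuous (fun z => lam *: iter n (T l) z)}.
      by apply: cvgZ; [exact: cvg_cst | exact: iter_continuous (cT l) x].
    exact: (cl _ (open_nbhs_nbhs (conj (open_lt_dist _ _) (hx l)))).
  by apply: filterS => z hz; exists n, lam.
have dG a : dense (G a).
  move=> O O0 oO.
  have := trT O (fun l => [set z | `|d (a.1 l) - z| < a.2.+1%:R^-1]) O0 oO.
  case=> [l|l|x [n [lam [Ox hx]]]].
  - by exists (d (a.1 l)); rewrite /= subrr normr0 invr_gt0 ltr0n.
  - exact: open_lt_dist.
  - by exists x; split => //; exists n, lam.
have dF := Cplx_Baire (F := F).
have {}dF : dense (\bigcap_k F k).
  apply: dF => m; rewrite /F; case: (unpickle m) => [a|] //=; first exact: openT.
  by move=> O [x Ox] _; exists x.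
move=> O O0 oO; have [x [Ox Fx]] := dF O O0 oO; exists x; split => //.
have joint : dense ([set y | exists (n : nat) (lambda : Cplx R),
    y = (fun l => lambda *: iter n (T l) x)]
    : set (prod_topology (fun _ : 'I_N => X))).
  move=> W [y Wy] oW; have [p hp] := open_prod_sub_box oW Wy.
  (* Halving the radius leaves room for replacing y by points of the dense
     sequence. *)
  pose q := (2 * p.+1).-1.
  have qE : q.+1%:R^-1 = p.+1%:R^-1 / 2 :> Cplx R.
    by rewrite /q prednK ?muln_gt0// natrM invfM mulrC.
  have hda l : exists k, `|y l - d k| < q.+1%:R^-1.
    apply: (hd [set z | `|y l - z| < q.+1%:R^-1]); last exact: open_lt_dist.
    by exists (y l); rewrite /= subrr normr0 invr_gt0 ltr0n.
  have [a ha] := choice hda.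
  have := Fx (pickle ([ffun l => a l], q)) I; rewrite /F pickleK /=.
  move=> [n [lam h]]; exists (fun l => lam *: iter n (T l) x).
  split; last by exists n, lam.
  apply: hp => l; have := h l; rewrite /= ffunE => hl.
  rewrite -(subrKA (d (a l))) (le_lt_trans (ler_normD _ _))//.
  by rewrite [ltRHS]splitr -qE ltrD.
split=> // l; exists x => W W0 oW.
have [|z [Wz [n [lam zE]]]] := joint _ _ (open_box (fun _ : 'I_N => oW)).
  by case: W0 => w Ww; exists (fun=> w).
by exists (z l); split; [exact: Wz | exists n, lam; rewrite zE].
Qed.

End Transitivity.
(** * Iterates of a weighted pseudo-shift *)

Section PseudoShift.
Variables (R : realType) (I : choiceType) (X : completeNormedModType (Cplx R)).
Variables (coord : X -> I -> Cplx R) (e : I -> X).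
Hypothesis hX : banach_sequence_space coord.
Hypothesis he : unit_vectors coord e.

Lemma coordD x y i : coord (x + y) i = coord x i + coord y i.
Proof. by have [sc _ _] := hX; have := sc i 1 x y; rewrite scale1r mul1r. Qed.

Lemma coord0 i : coord 0 i = 0.
Proof. by apply: (@addrI _ (coord 0 i)); rewrite -coordD !addr0. Qed.

Lemma coordZ a x i : coord (a *: x) i = a * coord x i.
Proof. by have [sc _ _] := hX; have := sc i a x 0; rewrite addr0 /= coord0 addr0. Qed.

Lemma coord_inj x y : (forall i, coord x i = coord y i) -> x = y.
Proof. by move=> h; have [_ inj _] := hX; apply: inj; apply/funext. Qed.

Lemma coord_sum_unit (s : seq I) i : uniq s ->
  coord (\sum_(j <- s) e j) i = (i \in s)%:R.
Proof.
elim: s => [|j s IH]; first by rewrite big_nil coord0.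
case/andP=> js us; rewrite big_cons coordD he IH// inE eq_sym.
by have [->|_] /= := eqVneq i j; rewrite ?(negPf js) ?addr0 ?add0r.
Qed.

Variables (b : I -> Cplx R) (phi : I -> I) (T : X -> X).
Hypothesis hT : weighted_pseudo_shift coord b phi T.

Lemma fwd_weightS m i :
  fwd_weight b phi m.+1 i = fwd_weight b phi m i * b (iter m phi i).
Proof. by rewrite /fwd_weight big_nat_recr. Qed.

Lemma fwd_weight_neq0 m i : fwd_weight b phi m i != 0.
Proof. by have [_ _ b0 _ _] := hT; rewrite prodf_seq_neq0; apply/allP => v _ /=. Qed.

Lemma coord_iter m x i :
  coord (iter m T x) i = fwd_weight b phi m i * coord x (iter m phi i).
Proof.
have [_ _ _ _ cT] := hT.
elim: m x => [|m IH] x; first by rewrite /fwd_weight big_geq// mul1r.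
by rewrite iterSr IH cT fwd_weightS mulrA.
Qed.

Lemma iter_phi_inj m : injective (iter m phi).
Proof.
have [_ _ _ inj _] := hT.
by elim: m => [|m IH] i j //= /inj /IH.
Qed.

Lemma iter_unit_image m i :
  iter m T (e (iter m phi i)) = fwd_weight b phi m i *: e i.
Proof.
apply: coord_inj => k; rewrite coord_iter coordZ !he (inj_eq (@iter_phi_inj m)).
by have [->//|_] := eqVneq i k; rewrite !mulr0.
Qed.

Lemma iter_unit_out m j : (forall i, iter m phi i != j) -> iter m T (e j) = 0.
Proof.
move=> h; apply: coord_inj => k.
by rewrite coord_iter he eq_sym (negPf (h k)) mulr0 coord0.
Qed.

Lemma iter_unitP m j :
  (exists2 i, iter m phi i = j & iter m T (e j) = fwd_weight b phi m i *: e i)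
  \/ iter m T (e j) = 0.
Proof.
have [[i <-]|h] := pselect (exists i, iter m phi i = j).
  by left; exists i => //; exact: iter_unit_image.
by right; apply: iter_unit_out => i; apply/eqP => hi; apply: h; exists i.
Qed.

(** The backward weights and vectors of the weight conditions, with their zero
convention outside the range of phi^m, are the iterates of T at unit vectors. *)
Lemma bwd_weight_e_psi m j :
  bwd_weight b phi m j *: e_psi e phi m j = iter m T (e j).
Proof.
have [linT _ _ _ _] := hT.
elim: m => [|m IH]; first by rewrite /bwd_weight big_geq// scale1r.
rewrite iterS -IH linearZ_of// /bwd_weight big_nat_recr//= -scalerA.
congr (_ *: _); rewrite /b_psi /e_psi /psi_iter iterS -/(psi_iter phi m j).
case: (psi_iter phi m j) => [i|] /=; last by rewrite scale0r linear0_of.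
rewrite /partial_inverse; case: pselect => [h|h] /=.
  case: (cid h) => k /= <-.
  have := iter_unit_image 1 k; rewrite /= => ->.
  by rewrite fwd_weightS /fwd_weight big_geq// mul1r.
rewrite scale0r; apply/esym/(@iter_unit_out 1) => k.
by apply/eqP => hk; apply: h; exists k.
Qed.

(** Values at unit vectors of the natural right inverse of T^m. *)
Definition fwd_vector m i : X := (fwd_weight b phi m i)^-1 *: e (iter m phi i).

Lemma iter_fwd_vector m i : iter m T (fwd_vector m i) = e i.
Proof.
have [linT _ _ _ _] := hT.
rewrite /fwd_vector linearZ_of; last exact: iter_linear.
by rewrite iter_unit_image scalerA mulVf ?scale1r// fwd_weight_neq0.
Qed.

End PseudoShift.

(** * Coordinates of vectors close to a sum of unit vectors *)

Section NearIndicator.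
Variables (R : realType) (I : choiceType) (X : completeNormedModType (Cplx R)).
Variables (coord : X -> I -> Cplx R) (e : I -> X).
Hypothesis hX : banach_sequence_space coord.
Hypothesis he : OP_basis coord e.

Let he1 : unit_vectors coord e. Proof. by case: he. Qed.

(** The distance of x to the indicator of I0 is measured coordinate by
coordinate, in norm: this is what equicontinuity of the coordinate projections
controls, and a bound on the coordinates themselves would not be uniform. *)
Definition near_indicator (I0 : seq I) (eta : Cplx R) (x : X) :=
  forall i, `|(coord x i - (i \in I0)%:R) *: e i| < eta.

Lemma near_indicatorP (I0 : seq I) (eta : Cplx R) : uniq I0 -> 0 < eta ->
  exists2 delta : Cplx R, 0 < delta &
    forall x, `|\sum_(i <- I0) e i - x| < delta -> near_indicator I0 eta x.
Proof.
move=> uI0 eta0; have [_ _ ec] := he.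
have hent := entourage_ball X (PosNum eta0).
have /nbhs_normP[d /= d0 hd] := ec (\sum_(i <- I0) e i) _ hent.
exists d => // x xd i; have := hd x xd i Logic.I.
rewrite /= -ball_normE /ball_ /= (coord_sum_unit hX)// => h.
by rewrite -normrN -scaleNr opprB scalerBl.
Qed.

Lemma half_le_norm (z eta : Cplx R) (v : X) :
  `|(z - 1) *: v| < eta -> 2 * eta <= `|v| -> 2^-1 <= `|z|.
Proof.
move=> h1 h2; have eta0 : 0 < eta by apply: le_lt_trans h1.
have v0 : 0 < `|v| by apply: lt_le_trans h2; rewrite mulr_gt0.
have z1 : `|1 - z| <= 2^-1.
  rewrite distrC -(ler_pM2r v0) -normrZ; apply: (le_trans (ltW h1)).
  by rewrite ler_pdivlMl.
have := ler_normD (1 - z) z; rewrite subrK normr1.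
move=> h; rewrite -(lerD2l 2^-1); have two : 2^-1 + 2^-1 = 1 :> Cplx R.
  by rewrite -div1r -splitr.
by rewrite two; apply: (le_trans h); rewrite lerD2r.
Qed.

Variables (I0 : seq I) (eta : Cplx R) (x : X) (lam : Cplx R).
Hypothesis eta0 : 0 < eta.
Hypothesis eta_e : forall i, i \in I0 -> 2 * eta <= `|e i|.
Hypothesis hx : near_indicator I0 eta x.

Lemma coord_ge_half i : i \in I0 -> 2^-1 <= `|coord x i|.
Proof.
by move=> iI0; apply: (half_le_norm _ (eta_e iI0)); have := hx i; rewrite iI0.
Qed.

Lemma coord_lt i : i \notin I0 -> `|coord x i| * `|e i| < eta.
Proof. by move=> /negPf iI0; have := hx i; rewrite iI0 subr0 normrZ. Qed.

Section OneShift.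
Variables (b : I -> Cplx R) (phi : I -> I) (T : X -> X) (m : nat).
Hypothesis hT : weighted_pseudo_shift coord b phi T.
Hypothesis hTx : near_indicator I0 eta (lam *: iter m T x).

Lemma orbit_coord i : coord (lam *: iter m T x) i =
  lam * (fwd_weight b phi m i * coord x (iter m phi i)).
Proof. by rewrite (coordZ hX) (coord_iter hT). Qed.

(** At i in I0 the coordinate of lambda T^m x is close to 1 and it equals
lambda times the weight times the coordinate of x at phi^m(i). *)
Lemma fwd_weight_inv_le i : i \in I0 ->
  `|(fwd_weight b phi m i)^-1| <= 2 * `|lam| * `|coord x (iter m phi i)|.
Proof.
move=> iI0; have w0 := fwd_weight_neq0 hT m i.
have := hTx i; rewrite iI0 orbit_coord => /half_le_norm/(_ (eta_e iI0)).
rewrite !normrM normfV => h.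
rewrite -[leLHS]mul1r ler_pdivrMr ?normr_gt0//.
move: h; rewrite -[2^-1]mulr1 ler_pdivrMl// => /le_trans; apply.
by rewrite !mulrA [leRHS]mulrAC.
Qed.

(** The index phi^m(i) lies off I0, where x contributes less than eta. *)
Lemma fwd_vector_le i : i \in I0 -> iter m phi i \notin I0 ->
  `|fwd_vector e b phi m i| <= 2 * `|lam| * eta.
Proof.
move=> iI0 piI0; rewrite /fwd_vector normrZ.
apply: le_trans (ler_wpM2r (normr_ge0 _) (fwd_weight_inv_le iI0)) _.
rewrite -[leLHS]mulrA; apply: ler_wpM2l; first by rewrite mulr_ge0.
by rewrite ltW// coord_lt.
Qed.

Lemma orbit_coord_lt i : i \notin I0 ->
  `|lam| * (`|fwd_weight b phi m i| * `|coord x (iter m phi i)|) * `|e i| < eta.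
Proof.
by move=> /negPf iI0; have := hTx i; rewrite iI0 subr0 normrZ orbit_coord !normrM.
Qed.

(** If j = phi^m(i), then i lies off I0, so the coordinate of lambda T^m x at i
contributes less than eta; that coordinate is the weight of T^m e_j multiplied by
lambda and by x_j, and x_j is close to 1. *)
Lemma iter_unit_le j : j \in I0 -> (forall i, i \in I0 -> iter m phi i \notin I0) ->
  `|lam| * `|iter m T (e j)| <= 2 * eta.
Proof.
move=> jI0 away; case: (iter_unitP hX he1 hT m j) => [[i ij ->]|->]; last first.
  by rewrite normr0 mulr0 mulr_ge0// ltW.
have iI0 : i \notin I0 by apply/negP => /away; rewrite ij jI0.
have := orbit_coord_lt iI0; rewrite ij => h.
rewrite -ler_pdivrMl//; apply: le_trans (ltW h).
have h2 := coord_ge_half jI0.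
rewrite normrZ [leRHS](_ : _ = `|coord x j|
  * (`|lam| * (`|fwd_weight b phi m i| * `|e i|))); last by ring.
by apply: ler_wpM2r => //; rewrite !mulr_ge0.
Qed.

End OneShift.

(** If phi1^m1(i) = phi2^m2(k), then k lies off I0.  The same coordinate of x,
at this common index, bounds the inverse of the first weight from above and
multiplies the second weight in the small coordinate at k of the second orbit,
so that both this coordinate and lambda cancel. *)
Lemma iter_fwd_vector_le b1 phi1 T1 m1 b2 phi2 T2 m2 i :
  weighted_pseudo_shift coord b1 phi1 T1 ->
  weighted_pseudo_shift coord b2 phi2 T2 ->
  near_indicator I0 eta (lam *: iter m1 T1 x) ->
  near_indicator I0 eta (lam *: iter m2 T2 x) ->
  i \in I0 ->
  (forall j k, j \in I0 -> k \in I0 -> iter m1 phi1 j != iter m2 phi2 k) ->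
  `|iter m2 T2 (fwd_vector e b1 phi1 m1 i)| <= 2 * eta.
Proof.
move=> h1 h2 n1 n2 iI0 away; have [lin2 _ _ _ _] := h2.
rewrite /fwd_vector linearZ_of; last exact: iter_linear.
rewrite normrZ; case: (iter_unitP hX he1 h2 m2 (iter m1 phi1 i)) => [[k ki ->]|->].
  have kI0 : k \notin I0.
    by apply/negP => kI0; have := away _ _ iI0 kI0; rewrite ki eqxx.
  have := orbit_coord_lt h2 n2 kI0; rewrite ki => h.
  apply: le_trans (ler_wpM2r (normr_ge0 _) (fwd_weight_inv_le h1 n1 iI0)) _.
  rewrite normrZ [leLHS](_ : _ = 2 * (`|lam| * (`|fwd_weight b2 phi2 m2 k|
    * `|coord x (iter m1 phi1 i)|) * `|e k|)); last by ring.
  by apply: ler_wpM2l => //; exact: ltW.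
by rewrite normr0 mulr0 mulr_ge0// ltW.
Qed.

End NearIndicator.
(** * From the weight conditions to the criterion *)

Section WeightConditions.
Variables (R : realType) (I : choiceType) (X : completeNormedModType (Cplx R)).
Variables (coord : X -> I -> Cplx R) (e : I -> X).
Hypothesis hX : banach_sequence_space coord.
Hypothesis he : OP_basis coord e.
Variables (N : nat) (r : 'I_N -> nat).
Variables (b : 'I_N -> I -> Cplx R) (phi : 'I_N -> I -> I) (T : 'I_N -> X -> X).
Hypothesis hT : forall l, weighted_pseudo_shift coord (b l) (phi l) (T l).

Let he1 : unit_vectors coord e. Proof. by case: he. Qed.
Let linT l : linear (T l). Proof. by case: (hT l). Qed.
Let contT l : continuous (T l). Proof. by case: (hT l). Qed.

Local Notation fwd l n i := (fwd_vector e (b l) (phi l) (r l * n) i).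
Local Notation Tr := (fun l : 'I_N => iter (r l) (T l)).

(** The weight conditions in terms of iterates of the T_l.  The two limits
required for s < l are one limit required for s <> l. *)
Definition decay_along (n : nat -> nat) :=
  (forall i j l s, (fun k => `|fwd l (n k) i| * `|iter (r s * n k) (T s) (e j)|)
     @ \oo --> (0 : Cplx R)) /\
  (forall i s l, s != l -> (fun k => `|iter (r l * n k) (T l) (fwd s (n k) i)|)
     @ \oo --> (0 : Cplx R)).

Lemma fwd_bwd_weight s l n i :
  ((fwd_weight (b s) (phi s) (r s * n) i)^-1
     * bwd_weight (b l) (phi l) (r l * n) (iter (r s * n) (phi s) i))
    *: e_psi e (phi l) (r l * n) (iter (r s * n) (phi s) i)
  = iter (r l * n) (T l) (fwd s n i).
Proof.
rewrite -scalerA (bwd_weight_e_psi hX he1 (hT l)) /fwd_vector linearZ_of//.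
exact: iter_linear.
Qed.

(** S_{l,k} need not be linear: it acts on one chosen expansion of its argument,
the same for all k, which suffices because all conditions are pointwise. *)
Lemma decay_criterion (n : nat -> nat) :
  decay_along n -> d_supercyclicity_criterion_wrt Tr n.
Proof.
move=> [hprod hcross]; have [_ dspan _] := he.
have hrep y : exists p : seq I * (I -> Cplx R),
    Defs.span e y -> y = \sum_(i <- p.1) p.2 i *: e i.
  have [[s [c ->]]|ny] := pselect (Defs.span e y); first by exists (s, c).
  by exists ([::], fun=> 0).
have [rep repE] := choice hrep.
pose S l k y := \sum_(i <- (rep y).1) (rep y).2 i *: fwd l (n k) i.
exists (Defs.span e), (fun=> Defs.span e), S; split => //.
- move=> l i y sy; rewrite /S; have yE := repE _ sy.
  have uE : (fun k => iter (n k) (Tr l) (S i k y) - (i == l)%:R *: y)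
     = (fun k => \sum_(a <- (rep y).1) (rep y).2 a *:
         (iter (r l * n k) (T l) (fwd i (n k) a) - (i == l)%:R *: e a)).
    apply/funext => k; rewrite iter_iter /S.
    have lin := @iter_linear _ _ _ (r l * n k) (linT l).
    rewrite (linear_sum_of _ _ _ lin) {3}yE scaler_sumr -sumrB.
    apply: eq_bigr => a _; rewrite (linearZ_of _ _ lin) scalerBr.
    by rewrite !scalerA mulrC.
  rewrite uE; apply: cvg0_sum => a.
  rewrite -[X in _ --> X](scaler0 _ ((rep y).2 a)); apply: cvgZ; first exact: cvg_cst.
  have [<-|il] := eqVneq i l.
    under eq_fun do rewrite (iter_fwd_vector hX he1 (hT i)) scale1r subrr.
    exact: cvg_cst.
  under eq_fun do rewrite scale0r subr0.
  by apply/norm_cvg0P; exact: hcross.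
- move=> l x y sx sy; have xE := repE _ sx.
  pose B k := \sum_(a <- (rep x).1) \sum_(j < N) \sum_(d <- (rep (y j)).1)
     (`|(rep x).2 a| * `|(rep (y j)).2 d|) *
     (`|fwd j (n k) d| * `|iter (r l * n k) (T l) (e a)|).
  apply: (@cvg0_le R _ B); last first.
    apply: cvg0_sum => a; apply: cvg0_sum => j; apply: cvg0_sum => d.
    by rewrite -[X in _ --> X](mulr0 (`|(rep x).2 a| * `|(rep (y j)).2 d|));
      apply: cvgM; [exact: cvg_cst | exact: hprod].
  move=> k; have lin := @iter_linear _ _ _ (r l * n k) (linT l).
  have B0 : 0 <= B k by do 3![apply: sumr_ge0 => ? _]; rewrite !mulr_ge0.
  rewrite ger0_norm ?mulr_ge0// ger0_norm// iter_iter {1}xE.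
  rewrite (linear_sum_of _ _ _ lin).
  apply: le_trans (ler_pM _ _ (ler_norm_sum _ _ _) (ler_norm_sum _ _ _)) _ => //.
  rewrite mulr_suml; apply: ler_sum => a _; rewrite mulr_sumr; apply: ler_sum => j _.
  rewrite (linearZ_of _ _ lin) normrZ /S.
  apply: le_trans (ler_wpM2l _ (ler_norm_sum _ _ _)) _; first by rewrite mulr_ge0.
  rewrite mulr_sumr; apply: ler_sum => d _; rewrite normrZ.
  by rewrite [leLHS]mulrACA [X in _ * X]mulrC.
Qed.

End WeightConditions.
(** * From d-supercyclicity to the weight conditions *)

Section LargeIndices.
Variables (R : realType) (X : completeNormedModType (Cplx R)).

Lemma Cplx_near1_avoid (bad : seq (Cplx R)) (eps : Cplx R) : 0 < eps ->
  exists2 c, `|1 - c| < eps & c \notin bad.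
Proof.
move=> e0.
have [|p hp] := @Cplx_pos_lower_bound R
  (eps :: [seq `|1 - z| | z <- bad & z != 1]).
  move=> x; rewrite inE => /orP[/eqP -> //|/mapP[z]].
  by rewrite mem_filter => /andP[z1 _] ->; rewrite normr_gt0 subr_eq0 eq_sym.
pose t : Cplx R := p.+1%:R^-1; have t0 : 0 < t by rewrite invr_gt0 ltr0n.
have dist : `|1 - (1 + t)| = t by rewrite opprD addNKr normrN gtr0_norm.
exists (1 + t); first by rewrite dist; apply: hp; rewrite inE eqxx.
apply/negP => bt; suff : t < t by rewrite ltxx.
apply: hp; rewrite inE; apply/orP; right; apply/mapP; exists (1 + t) => //.
by rewrite mem_filter bt andbT -subr_eq0 [1 + t]addrC addrK gt_eqF.
Qed.

Lemma open_neq_lincomb (Y : topologicalType) (g h : Y -> Cplx R) (u v : Cplx R) :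
  continuous g -> continuous h -> open [set y | g y * u - h y * v != 0].
Proof.
move=> cg ch.
have cgh : continuous (fun y => g y * u - h y * v).
  move=> y; apply: cvgB.
    by apply: cvgM; [exact: (cg y) | exact: cvg_cst].
  by apply: cvgM; [exact: (ch y) | exact: cvg_cst].
have closed0 : closed [set (0 : Cplx R)].
  by apply: accessible_closed_set1; apply: hausdorff_accessible; exact: norm_hausdorff.
have := open_comp (fun y _ => cgh y) (closed_openC closed0).
by congr open; apply/seteqP; split => y /= /eqP.
Qed.

Variable N : nat.
Implicit Types T : 'I_N -> X -> X.

(** Scalar multiples of the n-th joint iterate stay on a line, and their images
under g at the positions l0 and l1 keep the ratio of [u n] to [v n].  Replacing
the target f by c f at the position l1, with c close to 1 and different from
the finitely many ratios v n / u n for n <= n0, keeps these lines away. *)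
Lemma d_supercyclic_large_index T (x f : X) (g : X -> Cplx R) (l0 l1 : 'I_N)
    (n0 : nat) (delta : Cplx R) :
  d_supercyclic_vector T x -> scalar g -> continuous g -> g f != 0 ->
  l0 != l1 -> 0 < delta ->
  exists n (lam : Cplx R), (n0 < n)%N /\
    forall l, `|f - lam *: iter n (T l) x| < delta.
Proof.
move=> [_ joint] lg cg gf l01 d0.
have g0 : g 0 = 0 by have := lg (-1) 0 0; rewrite scaler0 addr0 mulN1r addNr.
have gZ a z : g (a *: z) = a * g z by have := lg a z 0; rewrite g0 !addr0.
pose u n := g (iter n (T l0) x).
pose v n := g (iter n (T l1) x).
(* When [u n] and [v n] both vanish, [h n] becomes the condition that the image
   at l0 is nonzero, which the n-th iterate still violates. *)
pose w n := if (u n == 0) && (v n == 0) then 1 else v n.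
pose P := prod_topology (fun _ : 'I_N => X).
pose h (n : nat) := [set y : P | g (y l0) * w n - g (y l1) * u n != 0].
have oh n : open (h n).
  have cgl (l : 'I_N) : continuous (fun y : P => g (y l)).
    move=> y; apply: (@continuous_comp _ _ _ (fun y : P => y l) g); last exact: cg.
    exact: (@proj_continuous 'I_N (fun _ => X) l).
  exact: open_neq_lincomb (cgl l0) (cgl l1).
pose B := [set y : P | forall l, `|f - y l| < delta].
pose O := B `&` [set y | forall n : 'I_n0.+1, h n y].
have oO : open O.
  apply: openI; first exact: open_box (fun _ => open_lt_dist f delta).
  by apply: (@open_forall P 'I_n0.+1 (fun n => h n)) => n; exact: oh.
have f1 : 0 < `|f| + 1 by rewrite ltr_wpDl.
have [c c1 cbad] := Cplx_near1_avoid [seq v n / u n | n <- iota 0 n0.+1]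
  (divr_gt0 d0 f1).
have [|y [[By hy] [n [lam yE]]]] := joint O _ oO.
  exists (fun l => if l == l1 then c *: f else f); split => [l|n] /=.
    case: eqP => _; last by rewrite subrr normr0.
    rewrite -{1}[f]scale1r -scalerBl normrZ.
    apply: le_lt_trans (_ : `|1 - c| * (`|f| + 1) < _).
      by rewrite ler_wpM2l// lerDl.
    by rewrite -ltr_pdivlMr.
  rewrite /h /= (negPf l01) eqxx gZ.
  rewrite [X in X != 0](_ : _ = g f * (w n - c * u n)); last by ring.
  rewrite mulf_neq0// subr_eq0 /w.
  have [->|un] /= := eqVneq (u n) 0.
    by rewrite mulr0; case: ifPn => // _; rewrite oner_eq0.
  apply: contra cbad => /eqP vn; apply/mapP; exists (n : nat).
    by rewrite mem_iota add0n ltn_ord.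
  by rewrite vn mulfK.
exists n, lam; split; last by move=> l; have := By l; rewrite yE.
rewrite ltnNge; apply/negP => nn0.
have hn : h n y := hy (Ordinal (nn0 : (n < n0.+1)%N)).
move/negP: hn; apply; rewrite yE !gZ -/(u n) -/(v n) /w.
case: ifP => [/andP[/eqP -> _]|_]; first by rewrite !mulr0 mul0r subr0.
by rewrite mulrAC subrr.
Qed.

End LargeIndices.

Section DecayOfSupercyclic.
Variables (R : realType) (I : choiceType) (X : completeNormedModType (Cplx R)).
Hypothesis hcount : countable [set: I].
Variable i0 : I.
Variables (coord : X -> I -> Cplx R) (e : I -> X).
Hypothesis hX : banach_sequence_space coord.
Hypothesis he : OP_basis coord e.
Variables (N : nat) (r : 'I_N -> nat) (l0 l1 : 'I_N).
Hypothesis l01 : l0 != l1.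
Hypothesis hr1 : forall l, (1 <= r l)%N.
Variables (b : 'I_N -> I -> Cplx R) (phi : 'I_N -> I -> I) (T : 'I_N -> X -> X).
Hypothesis hT : forall l, weighted_pseudo_shift coord (b l) (phi l) (T l).
Hypothesis hrun : forall l, run_away (phi l).
Hypothesis hrunw : forall s l : 'I_N, (s < l)%N ->
  run_away_with (iter (r s) (phi s)) (iter (r l) (phi l)).

Local Notation fwd l n i := (fwd_vector e (b l) (phi l) (r l * n) i).
Local Notation Tr := (fun l : 'I_N => iter (r l) (T l)).

Hypothesis dense_sc : dense [set x | d_supercyclic_vector Tr x].

Lemma eventually_separated (I0 : seq I) : exists n0, forall n, (n0 <= n)%N ->
  (forall l i, i \in I0 -> iter (r l * n) (phi l) i \notin I0) /\
  (forall s l i j, s != l -> i \in I0 -> j \in I0 ->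
     iter (r s * n) (phi s) i != iter (r l * n) (phi l) j).
Proof.
have fI0 : finite_set [set` I0] by exact: finite_seq.
have [p hp] := choice (fun l => hrun l fI0).
have hq (sl : 'I_N * 'I_N) : exists q, (sl.1 < sl.2)%N -> forall n, (q <= n)%N ->
    (iter n (iter (r sl.1) (phi sl.1)) @` [set` I0])
    `&` (iter n (iter (r sl.2) (phi sl.2)) @` [set` I0]) = set0.
  have [lt|_] := boolP (sl.1 < sl.2)%N; last by exists 0%N.
  by have [q hq] := hrunw lt fI0; exists q.
have [q {}hq] := choice hq.
exists (maxn (\max_l p l) (\max_sl q sl)) => n; rewrite geq_max => /andP[pn qn].
have sep (s l : 'I_N) i j : (s < l)%N -> i \in I0 -> j \in I0 ->
    iter (r s * n) (phi s) i != iter (r l * n) (phi l) j.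
  move=> sl iI jI; apply/eqP => ij.
  have qsl : (q (s, l) <= n)%N by apply: leq_trans qn; exact: leq_bigmax.
  have := hq (s, l) sl n qsl; rewrite -subset0 => /(_ (iter (r s * n) (phi s) i)).
  apply; split; first by exists i; rewrite ?iter_iter.
  by exists j; rewrite ?iter_iter.
split=> [l i iI|s l i j].
  apply/negP => piI.
  have pl : (p l <= r l * n)%N.
    apply: leq_trans (_ : n <= _)%N; last by rewrite leq_pmull.
    by apply: leq_trans pn; exact: leq_bigmax.
  have := hp l _ pl; rewrite -subset0 => /(_ (iter (r l * n) (phi l) i)).
  by apply; split => //; exists i.
rewrite -(inj_eq val_inj) neq_ltn => /orP[sl|ls] iI jI; first exact: sep.
by rewrite eq_sym; exact: sep.
Qed.

(** One step of the construction of the sequence n_k: indices beyond n0 at which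
all the quantities attached to a finite set of indices are small. *)
Lemma small_index (I0 : seq I) (eps : Cplx R) (n0 : nat) :
  uniq I0 -> i0 \in I0 -> 0 < eps ->
  exists n, [/\ (n0 < n)%N,
    forall i j l s, i \in I0 -> j \in I0 ->
      `|fwd l n i| * `|iter (r s * n) (T s) (e j)| < eps &
    forall i s l, i \in I0 -> s != l ->
      `|iter (r l * n) (T l) (fwd s n i)| < eps].
Proof.
move=> uI0 iI0 eps0; have [he1 _ _] := he.
have e_gt0 i : 0 < `|e i|.
  rewrite normr_gt0; apply/eqP => ei; have := he1 i i.
  by rewrite ei (coord0 hX) eqxx => /eqP; rewrite eq_sym oner_eq0.
(* eta <= |e_i| / 2 on I0 puts the coordinates on I0 within 1 / 2 of 1, and the
   bounds obtained are 4 * eta ^ 2 and 2 * eta. *)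
have [|p hp] := @Cplx_pos_lower_bound R (eps / 4 :: [seq `|e i| / 2 | i <- I0]).
  move=> z; rewrite inE => /orP[/eqP ->|/mapP[i _ ->]]; exact: divr_gt0.
pose eta : Cplx R := p.+1%:R^-1.
have eta0 : 0 < eta by rewrite invr_gt0 ltr0n.
have eta1 : eta <= 1 by rewrite invf_le1 ?ler1n ?ltr0n.
have eta_eps : 4 * eta < eps.
  by rewrite mulrC -ltr_pdivlMr//; apply: hp; rewrite inE eqxx.
have eta_e i : i \in I0 -> 2 * eta <= `|e i|.
  move=> ii; rewrite mulrC -ler_pdivlMr// ltW//; apply: hp.
  by rewrite inE; apply/orP; right; apply/mapP; exists i.
have [delta d0 hdelta] := near_indicatorP hX he uI0 eta0.
pose f := \sum_(i <- I0) e i.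
have [|x [/hdelta nx dx]] := dense_sc _ (open_lt_dist f delta).
  by exists f; rewrite /= subrr normr0.
have gf : coord f i0 != 0 by rewrite (coord_sum_unit hX he1)// iI0 oner_eq0.
have [scl _ cc] := hX.
have [n1 sep] := eventually_separated I0.
have [n [lam [nn hn]]] :=
  d_supercyclic_large_index (maxn n0 n1) dx (scl i0) (cc i0) gf l01 d0.
have [nn0 nn1] : (n0 < n)%N /\ (n1 <= n)%N.
  by move: nn; rewrite gtn_max => /andP[? /ltnW].
have [away apart] := sep n nn1.
have nT l : near_indicator coord e I0 eta (lam *: iter (r l * n) (T l) x).
  by rewrite -iter_iter; exact: hdelta (hn l).
exists n; split=> // [i j l s iI jI|i s l iI sl].
  have h1 := fwd_vector_le hX eta_e nx (hT l) (nT l) iI (away l i iI).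
  have h2 := iter_unit_le hX he eta0 eta_e nx (hT s) (nT s) jI (away s).
  apply: le_lt_trans eta_eps; apply: le_trans (ler_wpM2r (normr_ge0 _) h1) _.
  rewrite [leLHS](_ : _ = 2 * eta * (`|lam| * `|iter (r s * n) (T s) (e j)|));
    last by ring.
  apply: le_trans (ler_wpM2l _ h2) _; first by rewrite mulr_ge0 ?ltW.
  rewrite [leLHS](_ : _ = 4 * eta * eta); last by ring.
  by rewrite ler_piMr// mulr_ge0 ?ltW.
have h := iter_fwd_vector_le hX he eta0 eta_e (hT s) (hT l) (nT s) (nT l) iI
  (fun j k => apart s l j k sl).
apply: (le_lt_trans h); apply: le_lt_trans eta_eps.
by rewrite ler_wpM2r ?(ltW eta0)// ler_nat.
Qed.

(** The finite sets of indices exhaust I and the tolerance tends to 0.  The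
index i0 is put in each of them so that coordinate i0 can serve as the
functional of [d_supercyclic_large_index]. *)
Lemma d_supercyclic_decay : exists n : nat -> nat,
  [/\ increasing_seq n, forall k, (0 < n k)%N & decay_along e r b phi T n].
Proof.
have /countable_injP[c cinj] := hcount.
pose en (a : nat) := xget i0 [set i | c i = a].
have enc i : en (c i) = i.
  have : [set j | c j = c i] (en (c i)) by apply: (xgetPex i0); exists i.
  by move=> /cinj; apply; rewrite inE.
pose I0 k := undup (i0 :: [seq en a | a <- iota 0 k]).
have uI0 k : uniq (I0 k) by exact: undup_uniq.
have i0I0 k : i0 \in I0 k by rewrite mem_undup mem_head.
have memI0 i k : (c i < k)%N -> i \in I0 k.
  move=> ck; rewrite mem_undup inE; apply/orP; right; apply/mapP.
  by exists (c i); rewrite ?enc// mem_iota add0n.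
pose eps k : Cplx R := k.+1%:R^-1.
have eps0 k : 0 < eps k by rewrite invr_gt0 ltr0n.
have [f hf] := choice (fun kn : nat * nat =>
  small_index kn.2 (uI0 kn.1) (i0I0 kn.1) (eps0 kn.1)).
pose fix n k := f (k, if k is k'.+1 then n k' else 0%N).
have nP k : [/\ forall i j l s, i \in I0 k -> j \in I0 k ->
      `|fwd l (n k) i| * `|iter (r s * n k) (T s) (e j)| < eps k &
    forall i s l, i \in I0 k -> s != l ->
      `|iter (r l * n k) (T l) (fwd s (n k) i)| < eps k].
  by case: k => [|k]; [case: (hf (0%N, 0%N)) | case: (hf (k.+1, n k))].
have small (u : nat -> Cplx R) k0 : (forall k, (k0 <= k)%N -> `|u k| < eps k) ->
    u @ \oo --> (0 : Cplx R).
  move=> hu; apply/cvgr0Pnorm_lt => d d0; have [p hp] := Cplx_invn_small d0.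
  exists (maxn k0 p) => // k /=; rewrite geq_max => /andP[k0k pk].
  apply: lt_trans hp; apply: lt_le_trans (hu k k0k) _.
  by rewrite lef_pV2 ?posrE// ler_nat ltnS.
exists n; split.
- by apply/increasing_seqP => k; rewrite ltEnat /=; case: (hf (k.+1, n k)).
- by case=> [|k]; [have [h _ _] := hf (0%N, 0%N) | have [h _ _] := hf (k.+1, n k)];
    exact: leq_ltn_trans h.
- split=> [i j l s|i s l sl].
    apply: (small _ (maxn (c i) (c j)).+1) => k; rewrite gtn_max => /andP[ik jk].
    rewrite ger0_norm ?mulr_ge0//; have [h _] := nP k.
    by apply: h; exact: memI0.
  apply: (small _ (c i).+1) => k ik; rewrite normr_id; have [_ h] := nP k.
  by apply: h => //; exact: memI0.
Qed.

End DecayOfSupercyclic.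
(** * The equivalence *)

Theorem theorem3p1 (R : realType) (I : choiceType)
    (hcount : countable [set: I]) (hinf : infinite_set [set: I])
    (X : completeNormedModType (Cplx R))
    (coord : X -> I -> Cplx R) (hX : banach_sequence_space coord)
    (e : I -> X) (he : OP_basis coord e)
    (N : nat) (hN : (2 <= N)%N)
    (r : 'I_N -> nat) (hr1 : forall l, (1 <= r l)%N)
    (hr : forall s l : 'I_N, (s < l)%N -> (r s < r l)%N)
    (b : 'I_N -> I -> Cplx R) (phi : 'I_N -> I -> I) (T : 'I_N -> X -> X)
    (hT : forall l, weighted_pseudo_shift coord (b l) (phi l) (T l))
    (hrun : forall l, run_away (phi l))
    (hrunw : forall s l : 'I_N, (s < l)%N ->
       run_away_with (iter (r s) (phi s)) (iter (r l) (phi l))) :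
  let Tr := fun l : 'I_N => iter (r l) (T l) in
  let dense_d_supercyclic := dense [set x : X | d_supercyclic_vector Tr x] in
  let weight_conditions :=
    exists n : nat -> nat,
    [/\ increasing_seq n,
        forall k, (0 < n k)%N,
        forall (i j : I) (l s : 'I_N),
          (fun k =>
             `|(fwd_weight (b l) (phi l) (r l * n k) i)^-1
                 *: e (iter (r l * n k) (phi l) i)|
             * `|bwd_weight (b s) (phi s) (r s * n k) j
                 *: e_psi e (phi s) (r s * n k) j|) @ \oo
            --> (0 : Cplx R) &
        forall (i : I) (s l : 'I_N), (s < l)%N ->
          (fun k =>
             `|((fwd_weight (b s) (phi s) (r s * n k) i)^-1
                * bwd_weight (b l) (phi l) (r l * n k)
                    (iter (r s * n k) (phi s) i))
                 *: e_psi e (phi l) (r l * n k)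
                      (iter (r s * n k) (phi s) i)|) @ \oo
            --> (0 : Cplx R)
          /\
          (fun k =>
             `|((fwd_weight (b l) (phi l) (r l * n k) i)^-1
                * bwd_weight (b s) (phi s) (r s * n k)
                    (iter (r l * n k) (phi l) i))
                 *: e_psi e (phi s) (r s * n k)
                      (iter (r l * n k) (phi l) i)|) @ \oo
            --> (0 : Cplx R)] in
  let criterion := d_supercyclicity_criterion Tr in
  (dense_d_supercyclic <-> weight_conditions) /\
  (weight_conditions <-> criterion).
Proof.
move=> Tr dense_sc weights criterion.
have [he1 dspan _] := he.
have [i0 _] := infinite_setN0 hinf.
have linT l : linear (T l) by case: (hT l).
have contT l : continuous (T l) by case: (hT l).
have weightsE : weights <-> exists n : nat -> nat,
    [/\ increasing_seq n, forall k, (0 < n k)%N & decay_along e r b phi T n].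
  have crossE s l n i := fwd_bwd_weight hX he r hT s l n i.
  split=> -[n [n_incr n_gt0]].
    move=> hprod hcross; exists n; split=> //; split=> [i j l s|i s l].
      have := hprod i j l s.
      by under eq_fun do rewrite (bwd_weight_e_psi hX he1 (hT s)).
    rewrite -(inj_eq val_inj) neq_ltn => /orP[sl|ls].
      by have [+ _] := hcross i s l sl; under eq_fun do rewrite crossE.
    by have [_ +] := hcross i l s ls; under eq_fun do rewrite crossE.
  move=> [hprod hcross]; exists n; split=> // [i j l s|i s l sl].
    under eq_fun do rewrite (bwd_weight_e_psi hX he1 (hT s)).
    exact: hprod.
  have s_l : s != l by rewrite -(inj_eq val_inj) ltn_eqF.
  split; under eq_fun do rewrite crossE; apply: hcross => //.
  by rewrite eq_sym.
have d_w : dense_sc -> weights.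
  move=> hd; apply/weightsE.
  pose l0 : 'I_N := Ordinal (ltnW hN); pose l1 : 'I_N := Ordinal hN.
  exact: (d_supercyclic_decay hcount i0 hX he (l0 := l0) (l1 := l1) isT hr1 hT
    hrun hrunw hd).
have w_c : weights -> criterion.
  move=> /weightsE[n [n_incr n_gt0 hn]]; exists n; split=> //.
  exact: (decay_criterion hX he hT).
have c_d : criterion -> dense_sc.
  move=> [n [_ _ hn]]; apply: d_transitive_dense_d_supercyclic.
  - by move=> l; exact: iter_continuous.
  - by apply: (span_separable hcount) dspan; exists i0.
  - by apply: criterion_d_transitive hn => l; exact: iter_linear.
by split; split => // h; [apply/c_d/w_c | apply/d_w/c_d].
Qed.
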